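(* Let $\mathcal X$ be any additive category with finite direct sums and split idempotents. Then there is an equivalence of categories $$[\mathbb I,\mathcal X]\simeq[\Delta_{\mathrm{inj}}^{\mathrm{op}},\mathcal X]$$ between the category of cubical objects in $\mathcal X$ (functors $\mathbb I\to\mathcal X$) and the category of semi-simplicial objects in $\mathcal X$ (functors $\Delta_{\mathrm{inj}}^{\mathrm{op}}\to\mathcal X$).
   Context: $\mathbb I$ is the following category. Its objects are the sets $\langle k\rangle=\{-,1,2,\dots,k,+\}$, one for each natural number $k\ge 0$. A morphism $f\colon\langle k\rangle\to\langle h\rangle$ is a function with $f(-)=-$ and $f(+)=+$ such that, whenever $f(i),f(j)\notin\{-,+\}$, one has $i<j$ if and only if $f(i)<f(j)$ (in the usual order of integers). Composition is composition of functions. $\Delta_{\mathrm{inj}}$ is the category of finite ordinals (including the empty one) and injective order-preserving functions. $[\mathcal C,\mathcal X]$ denotes the category of functors $\mathcal C\to\mathcal X$ and natural transformations. *)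

(* Defs.v *)
From mathcomp Require Import all_boot ssralg.
From mathcomp Require Import boolp.

Set Implicit Arguments.
Unset Strict Implicit.
Unset Printing Implicit Defensive.

Import GRing.Theory.

Declare Scope cat_scope.
Delimit Scope cat_scope with cat.
Local Open Scope cat_scope.

Reserved Notation "g \oc f" (at level 40, left associativity).

(** * Categories, functors, natural transformations *)

Record category := Category {
  obj :> Type;
  hom : obj -> obj -> Type;
  idm : forall a, hom a a;
  comp : forall a b c, hom b c -> hom a b -> hom a c;
  comp_idl : forall a b (f : hom a b), comp (idm b) f = f;
  comp_idr : forall a b (f : hom a b), comp f (idm a) = f;
  compA : forall a b c d (h : hom c d) (g : hom b c) (f : hom a b),
    comp h (comp g f) = comp (comp h g) f
}.
Arguments hom {_} a b.
Arguments idm {_} a.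
Arguments comp {_ a b c} g f.
Notation "g \oc f" := (comp g f) : cat_scope.

Definition opposite (C : category) : category :=
  @Category C (fun a b => @hom C b a) (fun a => idm a)
    (fun a b c (g : @hom C c b) (f : @hom C b a) => f \oc g)
    (fun a b f => comp_idr f) (fun a b f => comp_idl f)
    (fun a b c d h g f => esym (compA f g h)).

Record functor (C D : category) := Functor {
  fobj :> C -> D;
  fmap : forall a b, hom a b -> hom (fobj a) (fobj b);
  fmap_id : forall a, fmap (idm a) = idm (fobj a);
  fmap_comp : forall a b c (g : hom b c) (f : hom a b),
    fmap (g \oc f) = fmap g \oc fmap f
}.
Arguments fmap {C D} F {a b} f : rename.

Definition functor_id (C : category) : functor C C :=
  @Functor C C id (fun a b f => f)
    (fun=> erefl) (fun _ _ _ _ _ => erefl).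

Lemma functor_comp_id (C D E : category) (G : functor D E) (F : functor C D) a :
  fmap G (fmap F (idm a)) = idm (G (F a)).
Proof. by rewrite !fmap_id. Qed.

Lemma functor_comp_comp (C D E : category) (G : functor D E) (F : functor C D)
    a b c (g : hom b c) (f : hom a b) :
  fmap G (fmap F (g \oc f)) = fmap G (fmap F g) \oc fmap G (fmap F f).
Proof. by rewrite !fmap_comp. Qed.

Definition functor_comp (C D E : category)
    (G : functor D E) (F : functor C D) : functor C E :=
  @Functor C E (fun a => G (F a)) (fun a b f => fmap G (fmap F f))
    (functor_comp_id G F) (@functor_comp_comp _ _ _ G F).

Record nattrans (C D : category) (F G : functor C D) := NatTrans {
  component :> forall a, hom (F a) (G a);
  naturality : forall a b (f : hom a b),
    component b \oc fmap F f = fmap G f \oc component a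
}.

Lemma nattrans_ext (C D : category) (F G : functor C D) (s t : nattrans F G) :
  (forall a, s a = t a) -> s = t.
Proof.
case: s t => [s sP] [t tP] /= st.
have {}st : s = t by exact: functional_extensionality_dep.
by subst t; congr NatTrans; apply: Prop_irrelevance.
Qed.

Lemma nattrans_id_natural (C D : category) (F : functor C D)
    a b (f : hom a b) :
  idm (F b) \oc fmap F f = fmap F f \oc idm (F a).
Proof. by rewrite comp_idl comp_idr. Qed.

Definition nattrans_id (C D : category) (F : functor C D) : nattrans F F :=
  NatTrans (@nattrans_id_natural C D F).

Lemma nattrans_comp_natural (C D : category) (F G H : functor C D)
    (t : nattrans G H) (s : nattrans F G) a b (f : hom a b) :
  (t b \oc s b) \oc fmap F f = fmap H f \oc (t a \oc s a).
Proof. by rewrite -compA naturality compA naturality compA. Qed.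

Definition nattrans_comp (C D : category) (F G H : functor C D)
    (t : nattrans G H) (s : nattrans F G) : nattrans F H :=
  NatTrans (nattrans_comp_natural t s).

Lemma nattrans_idl (C D : category) (F G : functor C D) (s : nattrans F G) :
  nattrans_comp (nattrans_id G) s = s.
Proof. by apply: nattrans_ext => a; apply: comp_idl. Qed.

Lemma nattrans_idr (C D : category) (F G : functor C D) (s : nattrans F G) :
  nattrans_comp s (nattrans_id F) = s.
Proof. by apply: nattrans_ext => a; apply: comp_idr. Qed.

Lemma nattrans_compA (C D : category) (F G H K : functor C D)
    (u : nattrans H K) (t : nattrans G H) (s : nattrans F G) :
  nattrans_comp u (nattrans_comp t s) = nattrans_comp (nattrans_comp u t) s.
Proof. by apply: nattrans_ext => a; apply: compA. Qed.

Definition functor_category (C D : category) : category :=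
  @Category (functor C D) (@nattrans C D) (@nattrans_id C D)
    (@nattrans_comp C D) (@nattrans_idl C D) (@nattrans_idr C D)
    (@nattrans_compA C D).

(** * Isomorphism and equivalence *)

Definition isomorphic (C : category) (a b : C) : Prop :=
  exists (f : hom a b) (g : hom b a), g \oc f = idm a /\ f \oc g = idm b.

(* An isomorphism in a functor category is a natural isomorphism. *)
Definition equivalent (C D : category) : Prop :=
  exists (F : functor C D) (G : functor D C),
    @isomorphic (functor_category C C) (functor_id C) (functor_comp G F) /\
    @isomorphic (functor_category D D) (functor_comp F G) (functor_id D).

(** * Additive categories *)

(* Categories enriched in abelian groups.  The axioms are not stated on top of
   [category] so that the universe of the hom-groups stays independent of that
   of the objects: large categories such as that of all abelian groups are
   then instances. *)
Record preadditive := Preadditive {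
  pobj :> Type;
  phom : pobj -> pobj -> zmodType;
  pid : forall a, phom a a;
  pcomp : forall a b c, phom b c -> phom a b -> phom a c;
  pcomp_idl : forall a b (f : phom a b), pcomp (pid b) f = f;
  pcomp_idr : forall a b (f : phom a b), pcomp f (pid a) = f;
  pcompA : forall a b c d (h : phom c d) (g : phom b c) (f : phom a b),
    pcomp h (pcomp g f) = pcomp (pcomp h g) f;
  pcompDl : forall a b c (g g' : phom b c) (f : phom a b),
    pcomp (g + g')%R f = (pcomp g f + pcomp g' f)%R;
  pcompDr : forall a b c (g : phom b c) (f f' : phom a b),
    pcomp g (f + f')%R = (pcomp g f + pcomp g f')%R
}.
Arguments phom {_} a b.
Arguments pid {_} a.
Arguments pcomp {_ a b c} g f.

Definition category_of_preadditive (X : preadditive) : category :=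
  @Category X (@phom X) (@pid X) (@pcomp X)
    (@pcomp_idl X) (@pcomp_idr X) (@pcompA X).
Coercion category_of_preadditive : preadditive >-> category.

(* [n = 0] gives a zero object. *)
Definition has_finite_direct_sums (X : preadditive) : Prop :=
  forall (n : nat) (A : 'I_n -> X),
  exists (S : X) (inj : forall i, phom (A i) S) (proj : forall i, phom S (A i)),
    [/\ forall i, pcomp (proj i) (inj i) = pid (A i),
        forall i j : 'I_n, i != j -> pcomp (proj j) (inj i) = 0%R
      & (\sum_(i < n) pcomp (inj i) (proj i))%R = pid S].

Definition has_split_idempotents (C : category) : Prop :=
  forall (a : C) (e : hom a a), e \oc e = e ->
  exists (b : C) (r : hom a b) (s : hom b a), r \oc s = idm b /\ s \oc r = e.

(** * The category of cubes *)

(* The set {-, 1, ..., k, +}; the integer [i.+1] is encoded by [i : 'I_k]. *)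
Inductive cube (k : nat) := Minus | Inner of 'I_k | Plus.
Arguments Minus {k}.
Arguments Inner {k} i.
Arguments Plus {k}.

(* Since [Minus] and [Plus] are fixed, only inner points can have inner
   images, so the order condition need only range over inner points. *)
Record cube_hom (k h : nat) := CubeHom {
  cube_fun :> cube k -> cube h;
  cube_minus : cube_fun Minus = Minus;
  cube_plus : cube_fun Plus = Plus;
  cube_mono : forall (i j : 'I_k) (i' j' : 'I_h),
    cube_fun (Inner i) = Inner i' -> cube_fun (Inner j) = Inner j' ->
    (i < j) = (i' < j')
}.

Lemma cube_hom_ext k h (f g : cube_hom k h) : f =1 g -> f = g.
Proof.
case: f g => [f f1 f2 f3] [g g1 g2 g3] /= fg.
have {}fg : f = g by exact: functional_extensionality_dep.
by subst g; congr CubeHom; apply: Prop_irrelevance.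
Qed.

Lemma cube_id_mono k (i j i' j' : 'I_k) :
  id (Inner i) = Inner i' -> id (Inner j) = Inner j' -> (i < j) = (i' < j').
Proof. by move=> [->] [->]. Qed.

Definition cube_id k : cube_hom k k :=
  @CubeHom k k id erefl erefl (@cube_id_mono k).

Lemma cube_comp_minus k h l (g : cube_hom h l) (f : cube_hom k h) :
  g (f Minus) = Minus.
Proof. by rewrite !cube_minus. Qed.

Lemma cube_comp_plus k h l (g : cube_hom h l) (f : cube_hom k h) :
  g (f Plus) = Plus.
Proof. by rewrite !cube_plus. Qed.

Lemma cube_comp_mono k h l (g : cube_hom h l) (f : cube_hom k h)
    (i j : 'I_k) (i' j' : 'I_l) :
  g (f (Inner i)) = Inner i' -> g (f (Inner j)) = Inner j' ->
  (i < j) = (i' < j').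
Proof.
case fi: (f (Inner i)) => [|u|]; rewrite ?cube_minus ?cube_plus // => gu.
case fj: (f (Inner j)) => [|v|]; rewrite ?cube_minus ?cube_plus // => gv.
by rewrite (cube_mono fi fj) (cube_mono gu gv).
Qed.

Definition cube_comp k h l (g : cube_hom h l) (f : cube_hom k h) :
    cube_hom k l :=
  @CubeHom k l (fun x => g (f x)) (cube_comp_minus g f) (cube_comp_plus g f)
    (@cube_comp_mono _ _ _ g f).

Lemma cube_comp_idl k h (f : cube_hom k h) : cube_comp (cube_id h) f = f.
Proof. exact: cube_hom_ext. Qed.

Lemma cube_comp_idr k h (f : cube_hom k h) : cube_comp f (cube_id k) = f.
Proof. exact: cube_hom_ext. Qed.

Lemma cube_compA k h l m
    (w : cube_hom l m) (g : cube_hom h l) (f : cube_hom k h) :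
  cube_comp w (cube_comp g f) = cube_comp (cube_comp w g) f.
Proof. exact: cube_hom_ext. Qed.

Definition CubeCat : category :=
  @Category nat cube_hom cube_id cube_comp
    cube_comp_idl cube_comp_idr cube_compA.

(** * Finite ordinals and injective order-preserving functions *)

(* The object [n] is the ordinal {0, ..., n-1}; [n = 0] is allowed. *)
Record dinj_hom (m n : nat) := DinjHom {
  dinj_fun :> 'I_m -> 'I_n;
  dinj_inj : injective dinj_fun;
  dinj_mono : forall i j : 'I_m, i <= j -> dinj_fun i <= dinj_fun j
}.

Lemma dinj_hom_ext m n (f g : dinj_hom m n) : f =1 g -> f = g.
Proof.
case: f g => [f f1 f2] [g g1 g2] /= fg.
have {}fg : f = g by exact: functional_extensionality_dep.
by subst g; congr DinjHom; apply: Prop_irrelevance.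
Qed.

Definition dinj_id n : dinj_hom n n :=
  @DinjHom n n id (@inj_id _) (fun _ _ le_ij => le_ij).

Definition dinj_comp m n p (g : dinj_hom n p) (f : dinj_hom m n) :
    dinj_hom m p :=
  @DinjHom m p (fun i => g (f i)) (inj_comp (@dinj_inj _ _ g) (@dinj_inj _ _ f))
    (fun i j le_ij => dinj_mono g (dinj_mono f le_ij)).

Lemma dinj_comp_idl m n (f : dinj_hom m n) : dinj_comp (dinj_id n) f = f.
Proof. exact: dinj_hom_ext. Qed.

Lemma dinj_comp_idr m n (f : dinj_hom m n) : dinj_comp f (dinj_id m) = f.
Proof. exact: dinj_hom_ext. Qed.

Lemma dinj_compA m n p q
    (h : dinj_hom p q) (g : dinj_hom n p) (f : dinj_hom m n) :
  dinj_comp h (dinj_comp g f) = dinj_comp (dinj_comp h g) f.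
Proof. exact: dinj_hom_ext. Qed.

Definition DeltaInj : category :=
  @Category nat dinj_hom dinj_id dinj_comp
    dinj_comp_idl dinj_comp_idr dinj_compA.

(* Main.v *)
(** The normalization [N C] of a cubical object [C] has as its [n]-th term the
summand of [C n] on which the commuting idempotents [p i], sending the inner
point [i] to [-] and fixing the others, all vanish; an injection [g : m -> n]
acts by the partial inverse of [g] that sends the points outside the image of
[g] to [+].  Conversely a semi-simplicial object [M] gives the cubical object
with [k]-th term the direct sum of [M #|S|] over the subsets [S] of [k].  A
morphism [f] of cubes is zero on the summand [S] if it sends some point of [S]
to [-]; otherwise its restriction to [S] factors uniquely as the partial
inverse of an injection [g : #|T| -> #|S|] followed by the inclusion of a
subset [T], and [f] maps the summand [S] to the summand [T] by [M g].
Decomposing the identity of [C k] as the product over [i] of [p i + (1 - p i)]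
identifies [C k] with the sum of the [N C #|S|]. *)

From mathcomp Require Import all_boot all_order ssralg.
From mathcomp Require Import boolp.
Require Import Defs.

Set Implicit Arguments.
Unset Strict Implicit.
Unset Printing Implicit Defensive.

Import Order.TTheory GRing.Theory.
Local Open Scope cat_scope.

(** * Natural isomorphisms *)

Lemma isomorphic_sym (C : category) (a b : C) : isomorphic a b -> isomorphic b a.
Proof. by move=> [f [g [gf fg]]]; exists g, f. Qed.

(** The chosen inverses are natural because the invertible components of [t] cancel from each
    square. The lemma serves at two levels: for functors into [X], and for functors between functor
    categories. *)
Lemma pointwise_iso_inverse (C D : category) (F G : functor C D)
    (t : nattrans F G) :
  (forall a, exists g : hom (G a) (F a),
     g \oc t a = idm (F a) /\ t a \oc g = idm (G a)) ->
  exists g : nattrans G F,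
    nattrans_comp g t = nattrans_id F /\ nattrans_comp t g = nattrans_id G.
Proof.
move=> tP; pose g a := sval (cid (tP a)).
have gt a : g a \oc t a = idm (F a) by rewrite /g; case: (cid _) => h [].
have tg a : t a \oc g a = idm (G a) by rewrite /g; case: (cid _) => h [].
have gN a b (f : hom a b) : g b \oc fmap G f = fmap F f \oc g a.
  rewrite -[RHS]comp_idl -(gt b) -[RHS]compA; congr (_ \oc _).
  by rewrite compA naturality -compA tg comp_idr.
by exists (NatTrans gN); split; apply: nattrans_ext => a /=.
Qed.

(** * Direct sums and split idempotents in preadditive categories *)

Local Canonical category_of_preadditive.

Definition zero_hom (X : preadditive) (a b : X) : hom a b := 0%R : phom a b.
Arguments zero_hom {X a b}.

Lemma comp_zerol (X : preadditive) (a b c : X) (f : hom a b) :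
  zero_hom \oc f = zero_hom :> hom a c.
Proof.
by apply: (addrI (@pcomp X a b c 0%R f)); rewrite -pcompDl addr0 [RHS]addr0.
Qed.

Lemma comp_zeror (X : preadditive) (a b c : X) (g : hom b c) :
  g \oc zero_hom = zero_hom :> hom a c.
Proof.
by apply: (addrI (@pcomp X a b c g 0%R)); rewrite -pcompDr addr0 [RHS]addr0.
Qed.

Definition sub_hom (X : preadditive) (a b : X) (f g : hom a b) : hom a b :=
  ((f : phom a b) - (g : phom a b))%R : phom a b.

Lemma sub_homxx (X : preadditive) (a b : X) (f : hom a b) :
  sub_hom f f = zero_hom.
Proof. exact: subrr. Qed.

Lemma sub_hom0 (X : preadditive) (a b : X) (f : hom a b) :
  sub_hom f zero_hom = f.
Proof. exact: subr0. Qed.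

Lemma sub_hom_eq0 (X : preadditive) (a b : X) (f g : hom a b) :
  sub_hom f g = zero_hom -> f = g.
Proof. exact: subr0_eq. Qed.

Lemma comp_subl (X : preadditive) (a b c : X) (f f' : hom b c) (g : hom a b) :
  sub_hom f f' \oc g = sub_hom (f \oc g) (f' \oc g).
Proof.
apply: (@addIr (phom a c) (pcomp f' g)).
by rewrite -[LHS]pcompDl /sub_hom !subrK.
Qed.

Lemma comp_subr (X : preadditive) (a b c : X) (f : hom b c) (g g' : hom a b) :
  f \oc sub_hom g g' = sub_hom (f \oc g) (f \oc g').
Proof.
apply: (@addIr (phom a c) (pcomp f g')).
by rewrite -[LHS]pcompDr /sub_hom !subrK.
Qed.

Lemma pcomp_suml (X : preadditive) (a b c : X) (I : Type) (r : seq I)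
    (P : pred I) (g : I -> phom b c) (f : phom a b) :
  pcomp (\sum_(i <- r | P i) g i)%R f = (\sum_(i <- r | P i) pcomp (g i) f)%R.
Proof.
by apply: (big_morph (fun g => pcomp g f)) => [? ?|];
  [exact: pcompDl | exact: comp_zerol].
Qed.

Lemma pcomp_sumr (X : preadditive) (a b c : X) (I : Type) (r : seq I)
    (P : pred I) (g : phom b c) (f : I -> phom a b) :
  pcomp g (\sum_(i <- r | P i) f i)%R = (\sum_(i <- r | P i) pcomp g (f i))%R.
Proof.
by apply: (big_morph (fun f => pcomp g f)) => [? ?|];
  [exact: pcompDr | exact: comp_zeror].
Qed.

(** Universal properties stand in for the sum formula, so that later arguments test maps on
    inclusions or projections instead of manipulating sums of morphisms. The index type is general
    because subsets will serve as indices. *)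
Record direct_sum (X : preadditive) (I : finType) (A : I -> X) := DirectSum {
  ds_obj :> obj X;
  ds_in : forall i, hom (A i) ds_obj;
  ds_out : forall i, hom ds_obj (A i);
  ds_copair : forall Y : X, (forall i, hom (A i) Y) -> hom ds_obj Y;
  ds_pair : forall Y : X, (forall i, hom Y (A i)) -> hom Y ds_obj;
  ds_out_in : forall i, ds_out i \oc ds_in i = idm (A i);
  ds_out_in_neq : forall i j, i != j -> ds_out j \oc ds_in i = zero_hom;
  ds_copairE : forall (Y : X) (f : forall i, hom (A i) Y) i,
    ds_copair f \oc ds_in i = f i;
  ds_pairE : forall (Y : X) (f : forall i, hom Y (A i)) i,
    ds_out i \oc ds_pair f = f i;
  ds_in_ext : forall (Y : X) (f g : hom ds_obj Y),
    (forall i, f \oc ds_in i = g \oc ds_in i) -> f = g;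
  ds_out_ext : forall (Y : X) (f g : hom Y ds_obj),
    (forall i, ds_out i \oc f = ds_out i \oc g) -> f = g
}.
Arguments ds_in {X I A} d i.
Arguments ds_out {X I A} d i.
Arguments ds_copair {X I A} d {Y} f.
Arguments ds_pair {X I A} d {Y} f.

Lemma direct_sum_exists (X : preadditive) (I : finType) (A : I -> X) :
  has_finite_direct_sums X -> inhabited (direct_sum A).
Proof.
move=> /(_ #|I| (fun n => A (enum_val n))) [S [inj' [proj' [pi' pi0' sumE']]]].
have [inj [proj [pi pi0 sumE]]] :
    exists (inj : forall i, phom (A i) S) (proj : forall i, phom S (A i)),
    [/\ forall i, pcomp (proj i) (inj i) = pid (A i),
        forall i j, i != j -> pcomp (proj j) (inj i) = 0%R
      & (\sum_i pcomp (inj i) (proj i))%R = pid S].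
  (* The given family is indexed by ordinals, and [enum_val (enum_rank i)] equals [i] only
     propositionally, hence the transport along [enum_rankK i]. *)
  pose inj i := ecast j (phom (A j) S) (enum_rankK i) (inj' (enum_rank i)).
  pose proj i := ecast j (phom S (A j)) (enum_rankK i) (proj' (enum_rank i)).
  exists inj, proj; split=> [i|i j neq_ij|].
  - rewrite /inj /proj; move: (enum_rank i) (enum_rankK i) => n e.
    by case: _ / e; apply: pi'.
  - have: enum_rank i != enum_rank j by rewrite (inj_eq enum_rank_inj).
    move=> /pi0'; rewrite /inj /proj.
    move: (enum_rank i) (enum_rankK i) (enum_rank j) (enum_rankK j) => m em n en.
    by case: _ / em; case: _ / en.
  rewrite -sumE' (reindex enum_rank) /=; last first.
    by apply: onW_bij; apply: enum_rank_bij.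
  apply: eq_bigr => i _; rewrite /inj /proj.
  by move: (enum_rank i) (enum_rankK i) => n e; case: _ / e.
pose copair (Y : X) (f : forall i, hom (A i) Y) : hom S Y :=
  (\sum_i pcomp (f i) (proj i))%R : phom S Y.
pose pair (Y : X) (f : forall i, hom Y (A i)) : hom Y S :=
  (\sum_i pcomp (inj i) (f i))%R : phom Y S.
split; apply: (@DirectSum X I A S inj proj copair pair pi pi0).
- move=> Y f i; rewrite /copair /comp /= pcomp_suml (bigD1 i) //= big1 => [|j ji].
    by rewrite addr0 -pcompA pi; apply: pcomp_idr.
  by rewrite -pcompA pi0 1?eq_sym //; apply: comp_zeror.
- move=> Y f i; rewrite /pair /comp /= pcomp_sumr (bigD1 i) //= big1 => [|j ji].
    by rewrite addr0 pcompA pi; apply: pcomp_idl.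
  by rewrite pcompA pi0 //; apply: comp_zerol.
- move=> Y f g fg; rewrite -[f]comp_idr -[g]comp_idr /comp /= -sumE !pcomp_sumr.
  by apply: eq_bigr => i _; rewrite !pcompA; congr pcomp; apply: fg.
- move=> Y f g fg; rewrite -[f]comp_idl -[g]comp_idl /comp /= -sumE !pcomp_suml.
  by apply: eq_bigr => i _; rewrite -!pcompA; congr pcomp; apply: fg.
Qed.

(* A splitting [s, r] of the product of the [1 - p i], for commuting
   idempotents [p i]. *)
Record null_part (X : preadditive) (a : X) (I : finType) (p : I -> hom a a) :=
  NullPart {
  np_obj :> obj X;
  np_r : hom a np_obj;
  np_s : hom np_obj a;
  np_rs : np_r \oc np_s = idm np_obj;
  np_ps : forall i, p i \oc np_s = zero_hom;
  np_rp : forall i, np_r \oc p i = zero_hom;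
  np_sr : forall (Y : X) (y : hom Y a),
    (forall i, p i \oc y = zero_hom) -> np_s \oc (np_r \oc y) = y;
  np_ext : forall (Y : X) (x y : hom a Y),
    x \oc np_s = y \oc np_s -> (forall i, x \oc p i = y \oc p i) -> x = y
}.

(** The idempotent to split is the product of the [1 - p i]: by commutation it annihilates every
    [p i] on either side, and it fixes any map on which all the [p i] vanish. *)
Lemma null_part_exists (X : preadditive) (a : X) (I : finType)
    (p : I -> hom a a) :
  has_split_idempotents X ->
  (forall i, p i \oc p i = p i) -> (forall i j, p i \oc p j = p j \oc p i) ->
  inhabited (null_part p).
Proof.
move=> splitX pp pC.
have [e [eC ep ye xe]] : exists e : hom a a,
  [/\ forall i, e \oc p i = p i \oc e,
      forall i, e \oc p i = zero_hom,
      forall (Y : X) (y : hom Y a),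
        (forall i, p i \oc y = zero_hom) -> e \oc y = y
    & forall (Y : X) (x : hom a Y),
        (forall i, x \oc p i = zero_hom) -> x \oc e = x].
  (* The product is built along a list [l]; only the annihilation clause depends on [l], the others
     hold at every stage. *)
  suff /(_ (enum I)) [e [eC ep ye xe]] : forall l : seq I, exists e : hom a a,
    [/\ forall i, e \oc p i = p i \oc e,
      forall i, i \in l -> e \oc p i = zero_hom,
      forall (Y : X) (y : hom Y a),
        (forall i, p i \oc y = zero_hom) -> e \oc y = y
    & forall (Y : X) (x : hom a Y),
        (forall i, x \oc p i = zero_hom) -> x \oc e = x].
    by exists e; split=> // i; rewrite ep ?mem_enum.
  elim=> [|j l [e [eC ep ye xe]]].
    exists (idm a); split=> // *; rewrite ?comp_idl ?comp_idr //.
  exists (sub_hom e (e \oc p j)); split=> [i|i|Y y py|Y x xp].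
  - by rewrite comp_subl comp_subr -compA (pC j i) compA eC -compA.
  - rewrite comp_subl inE -compA => /orP[/eqP->|il]; first by rewrite pp sub_homxx.
    by rewrite (pC j i) compA ep // comp_zerol sub_homxx.
  - by rewrite comp_subl -compA py comp_zeror sub_hom0 ye.
  - by rewrite comp_subr compA xe // xp sub_hom0.
have ee : e \oc e = e by apply: xe.
have [b [r [s [rs sr]]]] := splitX a e ee.
split; apply: (@NullPart X a I p b r s) => //.
- move=> i; rewrite -[s]comp_idr -rs (compA s r s) sr compA -eC ep.
  exact: comp_zerol.
- move=> i; rewrite -[r]comp_idl -rs -(compA r s r) sr -compA ep.
  exact: comp_zeror.
- by move=> Y y py; rewrite compA sr ye.
move=> Y x y xys xyp; apply: sub_hom_eq0.
(* The difference vanishes on all the [p i], so it equals its composite with [e], that is with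
   [s \oc r]; and it vanishes on [s] too. *)
rewrite -[sub_hom x y]xe => [|i]; last by rewrite comp_subl xyp sub_homxx.
by rewrite -sr compA comp_subl xys sub_homxx comp_zerol.
Qed.

Local Arguments comp : simpl never.
Local Arguments idm : simpl never.

(** * Factorizations in the category of cubes *)

Lemma dinj_ltn m n (d : dinj_hom m n) (i j : 'I_m) : (d i < d j) = (i < j).
Proof.
apply/idP/idP; first by apply: contraTT; rewrite -!leqNgt; apply: dinj_mono.
move=> ij; rewrite ltn_neqAle dinj_mono 1?ltnW // andbT.
by apply: contraTneq ij => /val_inj/dinj_inj ->; rewrite ltnn.
Qed.

Lemma cube_hom_inner_ext k h (f g : cube_hom k h) :
  (forall i, f (Inner i) = g (Inner i)) -> f = g.
Proof.
by move=> fg; apply: cube_hom_ext => -[|i|]; rewrite ?cube_minus ?cube_plus.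
Qed.

(** * Inclusions and partial inverses attached to an injection *)

Definition cube_inj_fun m n (d : 'I_m -> 'I_n) (x : cube m) : cube n :=
  match x with Minus => Minus | Inner i => Inner (d i) | Plus => Plus end.

Lemma cube_inj_mono m n (d : dinj_hom m n) (i j : 'I_m) (i' j' : 'I_n) :
  cube_inj_fun d (Inner i) = Inner i' -> cube_inj_fun d (Inner j) = Inner j' ->
  (i < j) = (i' < j').
Proof. by move=> [<-] [<-]; rewrite dinj_ltn. Qed.

Definition cube_inj m n (d : dinj_hom m n) : cube_hom m n :=
  @CubeHom m n (cube_inj_fun d) erefl erefl (@cube_inj_mono m n d).

(** Both ends are used: partial inverses ending at [+] give the semi-simplicial action, those ending
    at [-] the coordinates on the summands of a cubical object. *)
Definition cube_end (b : bool) k : cube k := if b then Plus else Minus.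

Definition cube_proj_fun (b : bool) m n (d : 'I_m -> 'I_n) (x : cube n) :
    cube m :=
  match x with
  | Minus => Minus
  | Inner j => if [pick i | d i == j] is Some i then Inner i else cube_end b m
  | Plus => Plus
  end.

Lemma cube_proj_mono b m n (d : dinj_hom m n) (i j : 'I_n) (i' j' : 'I_m) :
  cube_proj_fun b d (Inner i) = Inner i' ->
  cube_proj_fun b d (Inner j) = Inner j' -> (i < j) = (i' < j').
Proof.
rewrite /=; case: pickP => [u /eqP<- [<-]|_]; last by case: b.
by case: pickP => [v /eqP<- [<-]|_]; [rewrite dinj_ltn | case: b].
Qed.

(* The partial inverse of [d], sending the points outside its image to [+] if
   [b] holds and to [-] otherwise. *)
Definition cube_proj (b : bool) m n (d : dinj_hom m n) : cube_hom n m :=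
  @CubeHom n m (cube_proj_fun b d) erefl erefl (@cube_proj_mono b m n d).

Lemma cube_proj_image b m n (d : dinj_hom m n) i :
  cube_proj b d (Inner (d i)) = Inner i.
Proof.
by rewrite /=; case: pickP => [j /eqP/dinj_inj->|/(_ i)] //; rewrite eqxx.
Qed.

Lemma cube_proj_notin b m n (d : dinj_hom m n) j :
  (forall i, d i != j) -> cube_proj b d (Inner j) = cube_end b m.
Proof. by move=> dj; rewrite /=; case: pickP => // i /eqP dij; case/eqP: (dj i). Qed.

Lemma dinj_imageP m n (d : dinj_hom m n) j :
  (exists i, j = d i) \/ (forall i, d i != j).
Proof.
case: (pickP (fun i => d i == j)) => [i /eqP <-|nd]; first by left; exists i.
by right=> i; rewrite nd.
Qed.

Lemma cube_hom_end b k h (f : cube_hom k h) : f (cube_end b k) = cube_end b h.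
Proof. by case: b; rewrite /= ?cube_plus ?cube_minus. Qed.

Lemma cube_proj_id b k : cube_proj b (dinj_id k) = cube_id k.
Proof. by apply: cube_hom_inner_ext => i; apply: (cube_proj_image b (dinj_id k)). Qed.

(** A point outside the image of [g] is sent to an end, which the partial inverse of [f] fixes. The
    reversed order is the source of the opposite category in the theorem. *)
Lemma cube_proj_comp b m n p (g : dinj_hom n p) (f : dinj_hom m n) :
  cube_proj b (dinj_comp g f) = cube_comp (cube_proj b f) (cube_proj b g).
Proof.
apply: cube_hom_inner_ext => j.
rewrite -[RHS]/(cube_proj b f (cube_proj b g (Inner j))).
have [[i ->]|gj] := dinj_imageP g j; last first.
  rewrite (cube_proj_notin b gj) cube_hom_end cube_proj_notin // => i.
  exact: gj.
rewrite cube_proj_image; have [[l ->]|fi] := dinj_imageP f i.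
  by rewrite -[g (f l)]/(dinj_comp g f l) !cube_proj_image.
by rewrite !cube_proj_notin // => l; rewrite (inj_eq (@dinj_inj _ _ g)).
Qed.

Lemma cube_proj_inj b m n (d d' : dinj_hom m n) :
  cube_proj b d = cube_proj b d' -> d = d'.
Proof.
move=> dd'; apply: dinj_hom_ext => i.
have := cube_proj_image b d i; rewrite dd'.
have [[j ->]|d'i] := dinj_imageP d' (d i); first by rewrite cube_proj_image => -[->].
by rewrite cube_proj_notin //; case: b {dd'}.
Qed.

Lemma cube_proj_cube_inj b m n (d : dinj_hom m n) :
  cube_comp (cube_proj b d) (cube_inj d) = cube_id m.
Proof. by apply: cube_hom_inner_ext => i; apply: cube_proj_image. Qed.

(** * Idempotents deleting one point, and their absorption rules *)

Definition cube_kill_fun k (i : 'I_k) (x : cube k) : cube k :=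
  if x is Inner j then if j == i then Minus else Inner j else x.

Lemma cube_kill_mono k (i j l j' l' : 'I_k) :
  cube_kill_fun i (Inner j) = Inner j' -> cube_kill_fun i (Inner l) = Inner l' ->
  (j < l) = (j' < l').
Proof. by rewrite /=; case: ifP => // _ [->]; case: ifP => // _ [->]. Qed.

Definition cube_kill k (i : 'I_k) : cube_hom k k :=
  @CubeHom k k (cube_kill_fun i) erefl erefl (@cube_kill_mono k i).

Lemma cube_kill_idem k (i : 'I_k) :
  cube_comp (cube_kill i) (cube_kill i) = cube_kill i.
Proof. apply: cube_hom_inner_ext => j /=.
by case: (j =P i) => //= /eqP/negPf->.
Qed.

Lemma cube_killC k (i j : 'I_k) :
  cube_comp (cube_kill i) (cube_kill j) = cube_comp (cube_kill j) (cube_kill i).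
Proof.
apply: cube_hom_inner_ext => l /=.
by case li: (l == i); case lj: (l == j); rewrite /= ?li ?lj.
Qed.

(** This lemma and the next yield the vanishing criteria: a morphism sending an inner point to [-]
    acts as zero on the normal part of its source, and one missing an inner point becomes zero after
    projection to the normal part of its target. *)
Lemma comp_cube_kill k h (f : cube_hom k h) i :
  f (Inner i) = Minus -> cube_comp f (cube_kill i) = f.
Proof.
move=> fi; apply: cube_hom_inner_ext => j /=.
by case: eqP => // ->; rewrite fi cube_minus.
Qed.

Lemma cube_kill_comp k h (f : cube_hom k h) i :
  (forall j, f (Inner j) <> Inner i) -> cube_comp (cube_kill i) f = f.
Proof.
move=> fi; apply: cube_hom_inner_ext => j /=.
by case fj: (f (Inner j)) => [|l|] //=; case: eqP => // li; case: (fi j); rewrite fj li.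
Qed.

(** This is why partial inverses preserve normal parts: the idempotent moves to the source side,
    where it vanishes on the normal part. *)
Lemma cube_kill_proj m n (d : dinj_hom m n) i :
  cube_comp (cube_kill i) (cube_proj true d) =
  cube_comp (cube_proj true d) (cube_kill (d i)).
Proof.
apply: cube_hom_inner_ext => j.
rewrite -[LHS]/(cube_kill_fun i (cube_proj true d (Inner j))).
rewrite -[RHS]/(cube_proj true d (cube_kill_fun (d i) (Inner j))).
have [[l ->]|dj] := dinj_imageP d j; last first.
  by rewrite (cube_proj_notin _ dj) [_ (d i) _]/= eq_sym (negPf (dj i)) cube_proj_notin.
rewrite cube_proj_image /= (inj_eq (@dinj_inj _ _ d)).
by case: ifP => // _; rewrite -[RHS]/(cube_proj true d (Inner (d l))) cube_proj_image.
Qed.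

(** * Inclusions of subsets and unique factorization *)

Lemma set_inj_le k (S : {set 'I_k}) (i j : 'I_#|S|) :
  i <= j -> (Order.enum_val i : 'I_k) <= Order.enum_val j.
Proof. exact/etrans/(Order.EnumVal.le_enum_val (@le_total _ 'I_k)). Qed.

Definition set_inj k (S : {set 'I_k}) : dinj_hom #|S| k :=
  @DinjHom #|S| k Order.enum_val
    (@Order.EnumVal.enum_val_inj _ 'I_k S) (@set_inj_le k S).

Lemma set_injP k (S : {set 'I_k}) j : reflect (exists i, j = set_inj S i) (j \in S).
Proof.
apply: (iffP idP) => [jS|[i ->]]; last exact: Order.EnumVal.enum_valP.
by exists (Order.enum_rank_in jS j); rewrite /= Order.EnumVal.enum_rankK_in.
Qed.

(** [T] collects the inner values of [c]. Each is attained once because [c] is strictly monotone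
    where it stays inner, so [g] picks the preimages; every other inner point can only go to [+]. *)
Lemma cube_factor_exists m h (c : cube_hom m h) :
  (forall i, c (Inner i) <> Minus) ->
  exists (T : {set 'I_h}) (g : dinj_hom #|T| m),
    c = cube_comp (cube_inj (set_inj T)) (cube_proj true g).
Proof.
move=> cN; pose T := [set j : 'I_h |
  [exists i, if c (Inner i) is Inner j' then j' == j else false]].
have TP j : j \in T -> exists i, c (Inner i) = Inner j.
  rewrite inE => /existsP[i]; case ci: (c (Inner i)) => [|j'|] // /eqP <-.
  by exists i.
have gP (t : 'I_#|T|) : exists i, c (Inner i) = Inner (set_inj T t).
  by apply: TP; apply/set_injP; exists t.
pose g t := sval (cid (gP t)).
have gE t : c (Inner (g t)) = Inner (set_inj T t) by rewrite /g; case: (cid _).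
have g_inj : injective g.
  move=> s t gst; apply: (@dinj_inj _ _ (set_inj T)).
  by have := gE s; rewrite gst gE => -[].
have g_mono (s t : 'I_#|T|) : s <= t -> g s <= g t.
  rewrite leqNgt -(dinj_ltn (set_inj T)) => st; rewrite leqNgt.
  by rewrite (cube_mono (gE t) (gE s)).
exists T, (DinjHom g_inj g_mono); apply: cube_hom_inner_ext => i.
rewrite -[RHS]/(cube_inj (set_inj T) (cube_proj true (DinjHom g_inj g_mono) (Inner i))).
have [[t ->]|gi] := dinj_imageP (DinjHom g_inj g_mono) i.
  by rewrite cube_proj_image gE.
rewrite (cube_proj_notin _ gi) /=.
case ci: (c (Inner i)) => [|j|] //; first by case: (cN i).
have /set_injP[t jt] : j \in T by rewrite inE; apply/existsP; exists i; rewrite ci.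
(* [g t] and [i] have the same image under [c], so a strict order between them would contradict
   [cube_mono]. *)
case/eqP: (gi t) => /=; apply/val_inj; case: (ltngtP (g t) i) => //.
  by rewrite (cube_mono (gE t) ci) jt ltnn.
by rewrite (cube_mono ci (gE t)) jt ltnn.
Qed.

Lemma cube_factor_image m h (T : {set 'I_h}) (g : dinj_hom #|T| m) j :
  (exists i, cube_comp (cube_inj (set_inj T)) (cube_proj true g) (Inner i) = Inner j)
    <-> j \in T.
Proof.
split=> [[i]|/set_injP[t ->]]; last first.
  exists (g t); rewrite -[LHS]/(cube_inj (set_inj T) (cube_proj true g (Inner (g t)))).
  by rewrite cube_proj_image.
rewrite -[X in X = _ -> _]/(cube_inj (set_inj T) (cube_proj true g (Inner i))).
have [[t ->]|gi] := dinj_imageP g i; last by rewrite cube_proj_notin.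
by rewrite cube_proj_image => -[<-]; apply/set_injP; exists t.
Qed.

Lemma cube_inj_cancel k m n (d : dinj_hom m n) (f g : cube_hom k m) :
  cube_comp (cube_inj d) f = cube_comp (cube_inj d) g -> f = g.
Proof.
move=> fg; rewrite -[f]cube_comp_idl -[g]cube_comp_idl.
by rewrite -(cube_proj_cube_inj true d) -!cube_compA fg.
Qed.

Lemma cube_factor_neq_minus m h (T : {set 'I_h}) (g : dinj_hom #|T| m) i :
  cube_comp (cube_inj (set_inj T)) (cube_proj true g) (Inner i) <> Minus.
Proof.
rewrite -[X in X <> _]/(cube_inj (set_inj T) (cube_proj true g (Inner i))).
have [[t ->]|gi] := dinj_imageP g i; first by rewrite cube_proj_image.
by rewrite cube_proj_notin.
Qed.

(** [T] is recovered as the set of inner values; then the inclusion cancels and [cube_proj_inj]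
    recovers [g]. The type of [g] depends on [T], hence the equality of dependent pairs. *)
Lemma cube_factor_unique m h (T T' : {set 'I_h})
    (g : dinj_hom #|T| m) (g' : dinj_hom #|T'| m) :
  cube_comp (cube_inj (set_inj T)) (cube_proj true g) =
  cube_comp (cube_inj (set_inj T')) (cube_proj true g') ->
  existT (fun T : {set 'I_h} => dinj_hom #|T| m) T g = existT _ T' g'.
Proof.
move=> gg'; have TT' : T = T'.
  apply/setP => j; apply/idP/idP.
    by move=> /(cube_factor_image g); rewrite gg' => /cube_factor_image.
  by move=> /(cube_factor_image g'); rewrite -gg' => /cube_factor_image.
by subst T'; rewrite (cube_proj_inj (cube_inj_cancel gg')).
Qed.

(** Meant for [set_inj setT], which joins the provably but not definitionally equal numbers
    [#|[set: 'I_n]|] and [n]. *)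
Lemma dinj_bij m n (d : dinj_hom m n) : (forall j, exists i, j = d i) ->
  exists2 d' : dinj_hom n m, dinj_comp d' d = dinj_id m & dinj_comp d d' = dinj_id n.
Proof.
move=> dP; pose e j := sval (cid (dP j)).
have eE j : d (e j) = j by rewrite /e; case: (cid _).
have e_inj : injective e by move=> i j eij; rewrite -(eE i) eij eE.
have e_mono (i j : 'I_n) : i <= j -> e i <= e j.
  by rewrite leqNgt -(eE i) -(eE j) dinj_ltn -leqNgt !eE.
exists (DinjHom e_inj e_mono); apply: dinj_hom_ext => i /=; last exact: eE.
by apply: (@dinj_inj _ _ d); rewrite eE.
Qed.

(** * From semi-simplicial objects to cubical objects *)

Definition sact (X : preadditive) (M : functor (opposite DeltaInj) X) m n
    (g : dinj_hom m n) : hom (M n) (M m) :=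
  @fmap (opposite DeltaInj) X M n m g.

Lemma sact_id (X : preadditive) (M : functor (opposite DeltaInj) X) n :
  sact M (dinj_id n) = idm (M n).
Proof. exact: (@fmap_id (opposite DeltaInj)). Qed.

Lemma sact_comp (X : preadditive) (M : functor (opposite DeltaInj) X) m n p
    (g : dinj_hom n p) (f : dinj_hom m n) :
  sact M (dinj_comp g f) = sact M f \oc sact M g.
Proof. exact: (@fmap_comp (opposite DeltaInj) X M p n m f g). Qed.

Definition subset_sum (X : preadditive) (X_sums : has_finite_direct_sums X)
    (M : functor (opposite DeltaInj) X) k :
    direct_sum (fun S : {set 'I_k} => M #|S|) :=
  inhabited_witness (direct_sum_exists _ X_sums).

(* The Yoneda description of the cubical object: an element of [M m] and a
   morphism [c : m -> h] give an element of level [h].  Defining legs for all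
   [c], not only for the inclusions of subsets, makes [cubify_map] functorial
   by [cubify_map_leg]. *)
Definition subset_sum_leg (X : preadditive) (X_sums : has_finite_direct_sums X)
    (M : functor (opposite DeltaInj) X) m h (c : cube_hom m h) :
    hom (M m) (subset_sum X_sums M h) :=
  match pselect (exists x : {T : {set 'I_h} & dinj_hom #|T| m},
    c = cube_comp (cube_inj (set_inj (tag x))) (cube_proj true (tagged x))) with
  | left e => ds_in _ (tag (sval (cid e))) \oc sact M (tagged (sval (cid e)))
  | right _ => zero_hom
  end.

Lemma subset_sum_leg_factor (X : preadditive)
    (X_sums : has_finite_direct_sums X) (M : functor (opposite DeltaInj) X)
    m h (T : {set 'I_h}) (g : dinj_hom #|T| m) :
  subset_sum_leg X_sums M (cube_comp (cube_inj (set_inj T)) (cube_proj true g)) =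
  ds_in _ T \oc sact M g.
Proof.
rewrite /subset_sum_leg; case: pselect => [e|[]]; last by exists (existT _ T g).
case: (cid e) => -[T' g'] /= /cube_factor_unique gg'.
(* [F] bundles the leg as a function of the dependent pair, so that the uniqueness equation applies
   by congruence. *)
pose F (x : {T : {set 'I_h} & dinj_hom #|T| m}) :=
  ds_in (subset_sum X_sums M h) (tag x) \oc sact M (tagged x).
exact: (congr1 F (esym gg')).
Qed.

Lemma subset_sum_leg_minus (X : preadditive)
    (X_sums : has_finite_direct_sums X) (M : functor (opposite DeltaInj) X)
    m h (c : cube_hom m h) i :
  c (Inner i) = Minus -> subset_sum_leg X_sums M c = zero_hom.
Proof.
rewrite /subset_sum_leg; case: pselect => // -[[T g] /= cE] ci.
by case: (@cube_factor_neq_minus m h T g i); rewrite -cE.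
Qed.

Lemma subset_sum_leg_inj (X : preadditive)
    (X_sums : has_finite_direct_sums X) (M : functor (opposite DeltaInj) X)
    h (T : {set 'I_h}) :
  subset_sum_leg X_sums M (cube_inj (set_inj T)) = ds_in _ T.
Proof.
rewrite -[cube_inj _]cube_comp_idr -(cube_proj_id true) subset_sum_leg_factor.
by rewrite sact_id comp_idr.
Qed.

Lemma cube_factor_dec m h (c : cube_hom m h) :
  (exists i, c (Inner i) = Minus) \/
  exists (T : {set 'I_h}) (g : dinj_hom #|T| m),
    c = cube_comp (cube_inj (set_inj T)) (cube_proj true g).
Proof.
have [|nc] := pselect (exists i, c (Inner i) = Minus); first by left.
by right; apply: cube_factor_exists => i ci; apply: nc; exists i.
Qed.

(** In the Yoneda description this is the relation identifying an element at
    [cube_comp c (cube_proj true g)] with its image under [sact M g] at [c]. *)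
Lemma subset_sum_leg_proj (X : preadditive)
    (X_sums : has_finite_direct_sums X) (M : functor (opposite DeltaInj) X)
    m n h (c : cube_hom m h) (g : dinj_hom m n) :
  subset_sum_leg X_sums M (cube_comp c (cube_proj true g)) =
  subset_sum_leg X_sums M c \oc sact M g.
Proof.
have [[i ci]|[T [d ->]]] := cube_factor_dec c.
  rewrite (subset_sum_leg_minus X_sums M ci) comp_zerol.
  apply: (@subset_sum_leg_minus _ _ _ _ _ _ (g i)).
  by rewrite -ci -(cube_proj_image true g i).
rewrite -cube_compA -cube_proj_comp !subset_sum_leg_factor sact_comp.
exact: compA.
Qed.

Definition cubify_map (X : preadditive) (X_sums : has_finite_direct_sums X)
    (M : functor (opposite DeltaInj) X) k h (f : cube_hom k h) :
    hom (subset_sum X_sums M k) (subset_sum X_sums M h) :=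
  ds_copair _ (fun S =>
    subset_sum_leg X_sums M (cube_comp f (cube_inj (set_inj S)))).

(** For inclusions of subsets this is the definition. A factored [c] reduces to that case by
    [subset_sum_leg_proj]; any other [c] hits [-], which [f] fixes, and both sides vanish. *)
Lemma cubify_map_leg (X : preadditive) (X_sums : has_finite_direct_sums X)
    (M : functor (opposite DeltaInj) X) m k h (f : cube_hom k h)
    (c : cube_hom m k) :
  cubify_map X_sums M f \oc subset_sum_leg X_sums M c =
  subset_sum_leg X_sums M (cube_comp f c).
Proof.
have [[i ci]|[T [d ->]]] := cube_factor_dec c.
  rewrite (subset_sum_leg_minus X_sums M ci) comp_zeror.
  by rewrite (@subset_sum_leg_minus _ _ _ _ _ _ i) //= ci cube_minus.
rewrite subset_sum_leg_factor cube_compA subset_sum_leg_proj compA.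
by rewrite ds_copairE.
Qed.

Lemma subset_sum_ext (X : preadditive) (X_sums : has_finite_direct_sums X)
    (M : functor (opposite DeltaInj) X) k (Y : X)
    (f g : hom (subset_sum X_sums M k) Y) :
  (forall S : {set 'I_k},
    f \oc subset_sum_leg X_sums M (cube_inj (set_inj S)) =
    g \oc subset_sum_leg X_sums M (cube_inj (set_inj S))) -> f = g.
Proof.
by move=> fg; apply: ds_in_ext => S; rewrite -subset_sum_leg_inj fg.
Qed.

Lemma cubify_map_id (X : preadditive) (X_sums : has_finite_direct_sums X)
    (M : functor (opposite DeltaInj) X) k :
  cubify_map X_sums M (cube_id k) = idm (subset_sum X_sums M k).
Proof.
by apply: subset_sum_ext => S; rewrite cubify_map_leg comp_idl cube_comp_idl.
Qed.

Lemma cubify_map_comp (X : preadditive) (X_sums : has_finite_direct_sums X)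
    (M : functor (opposite DeltaInj) X) k h l
    (g : cube_hom h l) (f : cube_hom k h) :
  cubify_map X_sums M (cube_comp g f) =
  cubify_map X_sums M g \oc cubify_map X_sums M f.
Proof.
by apply: subset_sum_ext => S; rewrite -compA !cubify_map_leg cube_compA.
Qed.

Definition cubify_obj (X : preadditive) (X_sums : has_finite_direct_sums X)
    (M : functor (opposite DeltaInj) X) : functor CubeCat X :=
  @Functor CubeCat X (fun k => subset_sum X_sums M k)
    (cubify_map X_sums M) (cubify_map_id X_sums M) (@cubify_map_comp X X_sums M).

Definition cubify_component (X : preadditive)
    (X_sums : has_finite_direct_sums X) (M M' : functor (opposite DeltaInj) X)
    (t : nattrans M M') (k : nat) :
    hom (subset_sum X_sums M k) (subset_sum X_sums M' k) :=
  ds_copair _ (fun S : {set 'I_k} => ds_in (subset_sum X_sums M' k) S \oc t #|S|).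

Lemma cubify_component_leg (X : preadditive)
    (X_sums : has_finite_direct_sums X) (M M' : functor (opposite DeltaInj) X)
    (t : nattrans M M') m k (c : cube_hom m k) :
  cubify_component X_sums t k \oc subset_sum_leg X_sums M c =
  subset_sum_leg X_sums M' c \oc t m.
Proof.
have [[i ci]|[T [d ->]]] := cube_factor_dec c.
  by rewrite !(subset_sum_leg_minus _ _ ci) comp_zeror comp_zerol.
rewrite !subset_sum_leg_factor compA ds_copairE -!compA; congr (_ \oc _).
exact: (@naturality _ _ _ _ t m #|T| d).
Qed.

Lemma cubify_component_natural (X : preadditive)
    (X_sums : has_finite_direct_sums X) (M M' : functor (opposite DeltaInj) X)
    (t : nattrans M M') k h (f : cube_hom k h) :
  cubify_component X_sums t h \oc cubify_map X_sums M f =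
  cubify_map X_sums M' f \oc cubify_component X_sums t k.
Proof.
apply: subset_sum_ext => S; rewrite -!compA cubify_map_leg !cubify_component_leg.
by rewrite compA cubify_map_leg.
Qed.

Definition cubify_nattrans (X : preadditive)
    (X_sums : has_finite_direct_sums X) (M M' : functor (opposite DeltaInj) X)
    (t : nattrans M M') :
    nattrans (cubify_obj X_sums M) (cubify_obj X_sums M') :=
  @NatTrans CubeCat X (cubify_obj X_sums M) (cubify_obj X_sums M')
    (cubify_component X_sums t) (@cubify_component_natural X X_sums M M' t).

Lemma cubify_nattrans_id (X : preadditive)
    (X_sums : has_finite_direct_sums X) (M : functor (opposite DeltaInj) X) :
  cubify_nattrans X_sums (nattrans_id M) = nattrans_id (cubify_obj X_sums M).
Proof.
apply: nattrans_ext => k; apply: subset_sum_ext => S.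
apply: etrans (cubify_component_leg X_sums (nattrans_id M) _) _.
exact: etrans (comp_idr _) (esym (comp_idl _)).
Qed.

Lemma cubify_nattrans_comp (X : preadditive)
    (X_sums : has_finite_direct_sums X)
    (M M' M'' : functor (opposite DeltaInj) X)
    (t' : nattrans M' M'') (t : nattrans M M') :
  cubify_nattrans X_sums (nattrans_comp t' t) =
  nattrans_comp (cubify_nattrans X_sums t') (cubify_nattrans X_sums t).
Proof.
apply: nattrans_ext => k; apply: subset_sum_ext => S.
apply: etrans (cubify_component_leg X_sums (nattrans_comp t' t) _) _.
rewrite [nattrans_comp t' t _]/= compA -cubify_component_leg -compA.
by rewrite -cubify_component_leg; apply: compA.
Qed.

Definition cubify (X : preadditive) (X_sums : has_finite_direct_sums X) :
    functor (functor_category (opposite DeltaInj) X)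
            (functor_category CubeCat X) :=
  @Functor (functor_category (opposite DeltaInj) X) (functor_category CubeCat X)
    (cubify_obj X_sums) (@cubify_nattrans X X_sums)
    (@cubify_nattrans_id X X_sums) (@cubify_nattrans_comp X X_sums).

(** * Normalization of cubical objects *)

Definition cact (X : preadditive) (C : functor CubeCat X) k h
    (f : cube_hom k h) : hom (C k) (C h) := @fmap CubeCat X C k h f.

Lemma cact_id (X : preadditive) (C : functor CubeCat X) k :
  cact C (cube_id k) = idm (C k).
Proof. exact: (@fmap_id CubeCat). Qed.

Lemma cact_comp (X : preadditive) (C : functor CubeCat X) k h l
    (g : cube_hom h l) (f : cube_hom k h) :
  cact C (cube_comp g f) = cact C g \oc cact C f.
Proof. exact: (@fmap_comp CubeCat). Qed.

Lemma cact_natural (X : preadditive) (C C' : functor CubeCat X)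
    (t : nattrans C C') k h (f : cube_hom k h) :
  t h \oc cact C f = cact C' f \oc t k.
Proof. exact: (@naturality CubeCat). Qed.

Definition normal_part (X : preadditive) (X_split : has_split_idempotents X)
    (C : functor CubeCat X) k : null_part (fun i => cact C (@cube_kill k i)) :=
  inhabited_witness (null_part_exists X_split
    (fun i => etrans (esym (cact_comp C _ _)) (congr1 _ (cube_kill_idem i)))
    (fun i j => etrans (esym (cact_comp C _ _))
       (etrans (congr1 _ (cube_killC i j)) (cact_comp C _ _)))).

Definition nr (X : preadditive) (X_split : has_split_idempotents X)
    (C : functor CubeCat X) k : hom (C k) (normal_part X_split C k) :=
  np_r (normal_part X_split C k).

Definition ns (X : preadditive) (X_split : has_split_idempotents X)
    (C : functor CubeCat X) k : hom (normal_part X_split C k : obj X) (C k) :=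
  np_s (normal_part X_split C k).

Lemma nr_ns (X : preadditive) (X_split : has_split_idempotents X)
    (C : functor CubeCat X) k :
  nr X_split C k \oc ns X_split C k = idm (normal_part X_split C k : obj X).
Proof. exact: np_rs. Qed.

Lemma cact_ns_minus (X : preadditive) (X_split : has_split_idempotents X)
    (C : functor CubeCat X) k h (f : cube_hom k h) i :
  f (Inner i) = Minus -> cact C f \oc ns X_split C k = zero_hom.
Proof.
move=> /comp_cube_kill <-; rewrite cact_comp -compA np_ps.
exact: comp_zeror.
Qed.

Lemma nr_cact_miss (X : preadditive) (X_split : has_split_idempotents X)
    (C : functor CubeCat X) k h (f : cube_hom k h) i :
  (forall j, f (Inner j) <> Inner i) -> nr X_split C h \oc cact C f = zero_hom.
Proof.
move=> /cube_kill_comp <-; rewrite cact_comp compA np_rp.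
exact: comp_zerol.
Qed.

Lemma ns_nr_proj (X : preadditive) (X_split : has_split_idempotents X)
    (C : functor CubeCat X) m n (g : dinj_hom m n) :
  ns X_split C m \oc (nr X_split C m \oc
    (cact C (cube_proj true g) \oc ns X_split C n)) =
  cact C (cube_proj true g) \oc ns X_split C n.
Proof.
apply: np_sr => i; rewrite compA -cact_comp cube_kill_proj.
apply: (@cact_ns_minus _ _ _ _ _ _ (g i)).
by rewrite -[LHS]/(cube_proj true g (cube_kill_fun (g i) (Inner (g i)))) /= eqxx.
Qed.

Lemma ns_nr_natural (X : preadditive) (X_split : has_split_idempotents X)
    (C C' : functor CubeCat X) (t : nattrans C C') n :
  ns X_split C' n \oc (nr X_split C' n \oc (t n \oc ns X_split C n)) =
  t n \oc ns X_split C n.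
Proof.
apply: np_sr => i; rewrite compA -cact_natural -compA np_ps.
exact: comp_zeror.
Qed.

Definition normalize_map (X : preadditive) (X_split : has_split_idempotents X)
    (C : functor CubeCat X) m n (g : dinj_hom m n) :
    hom (normal_part X_split C n : obj X) (normal_part X_split C m) :=
  nr X_split C m \oc (cact C (cube_proj true g) \oc ns X_split C n).

Lemma ns_normalize_map (X : preadditive) (X_split : has_split_idempotents X)
    (C : functor CubeCat X) m n (g : dinj_hom m n) :
  ns X_split C m \oc normalize_map X_split C g =
  cact C (cube_proj true g) \oc ns X_split C n.
Proof. exact: ns_nr_proj. Qed.

(** Since [ns] is a split monomorphism, identities between maps into normal parts may be checked
    inside the cubical object, where [normalize_map] becomes the plain action. *)
Lemma ns_mono (X : preadditive) (X_split : has_split_idempotents X)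
    (C : functor CubeCat X) n (Y : X)
    (f g : hom Y (normal_part X_split C n : obj X)) :
  ns X_split C n \oc f = ns X_split C n \oc g -> f = g.
Proof.
by move=> fg; rewrite -[f]comp_idl -[g]comp_idl -nr_ns -!compA fg.
Qed.

Lemma normalize_map_id (X : preadditive) (X_split : has_split_idempotents X)
    (C : functor CubeCat X) n :
  normalize_map X_split C (dinj_id n) = idm (normal_part X_split C n : obj X).
Proof.
by apply: ns_mono; rewrite ns_normalize_map cube_proj_id cact_id comp_idl comp_idr.
Qed.

Lemma normalize_map_comp (X : preadditive) (X_split : has_split_idempotents X)
    (C : functor CubeCat X) p n m (g : dinj_hom m n) (f : dinj_hom n p) :
  normalize_map X_split C (dinj_comp f g) =
  normalize_map X_split C g \oc normalize_map X_split C f.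
Proof.
apply: ns_mono.
rewrite [RHS]compA !ns_normalize_map -[RHS]compA ns_normalize_map.
by rewrite compA -cact_comp -cube_proj_comp.
Qed.

Definition normalize_obj (X : preadditive) (X_split : has_split_idempotents X)
    (C : functor CubeCat X) : functor (opposite DeltaInj) X :=
  @Functor (opposite DeltaInj) X (fun n => normal_part X_split C n)
    (fun n m g => @normalize_map X X_split C m n g)
    (normalize_map_id X_split C)
    (fun p n m g f => @normalize_map_comp X X_split C p n m g f).

Definition normalize_component (X : preadditive)
    (X_split : has_split_idempotents X) (C C' : functor CubeCat X)
    (t : nattrans C C') (n : nat) :
    hom (normal_part X_split C n : obj X) (normal_part X_split C' n) :=
  nr X_split C' n \oc (t n \oc ns X_split C n).

Lemma ns_normalize_component (X : preadditive)
    (X_split : has_split_idempotents X) (C C' : functor CubeCat X)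
    (t : nattrans C C') (n : nat) :
  ns X_split C' n \oc normalize_component X_split t n = t n \oc ns X_split C n.
Proof. exact: ns_nr_natural. Qed.

Lemma normalize_component_natural (X : preadditive)
    (X_split : has_split_idempotents X) (C C' : functor CubeCat X)
    (t : nattrans C C') m n (g : dinj_hom m n) :
  normalize_component X_split t m \oc normalize_map X_split C g =
  normalize_map X_split C' g \oc normalize_component X_split t n.
Proof.
apply: ns_mono.
rewrite [LHS]compA [RHS]compA ns_normalize_component ns_normalize_map -!compA.
rewrite ns_normalize_map ns_normalize_component [LHS]compA cact_natural.
by rewrite -compA.
Qed.

Definition normalize_nattrans (X : preadditive)
    (X_split : has_split_idempotents X) (C C' : functor CubeCat X)
    (t : nattrans C C') :
    nattrans (normalize_obj X_split C) (normalize_obj X_split C') :=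
  @NatTrans (opposite DeltaInj) X (normalize_obj X_split C)
    (normalize_obj X_split C') (normalize_component X_split t)
    (fun n m g => @normalize_component_natural X X_split C C' t m n g).

Lemma normalize_nattrans_id (X : preadditive)
    (X_split : has_split_idempotents X) (C : functor CubeCat X) :
  normalize_nattrans X_split (nattrans_id C) =
  nattrans_id (normalize_obj X_split C).
Proof.
apply: nattrans_ext => n; apply: ns_mono.
apply: etrans (ns_normalize_component X_split (nattrans_id C) n) _.
exact: etrans (comp_idl _) (esym (comp_idr _)).
Qed.

Lemma normalize_nattrans_comp (X : preadditive)
    (X_split : has_split_idempotents X) (C C' C'' : functor CubeCat X)
    (t' : nattrans C' C'') (t : nattrans C C') :
  normalize_nattrans X_split (nattrans_comp t' t) =
  nattrans_comp (normalize_nattrans X_split t') (normalize_nattrans X_split t).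
Proof.
apply: nattrans_ext => n; apply: ns_mono.
apply: etrans (ns_normalize_component X_split (nattrans_comp t' t) n) _.
rewrite [nattrans_comp t' t n]/= -compA -ns_normalize_component compA.
by rewrite -ns_normalize_component -compA.
Qed.

Definition normalize (X : preadditive) (X_split : has_split_idempotents X) :
    functor (functor_category CubeCat X)
            (functor_category (opposite DeltaInj) X) :=
  @Functor (functor_category CubeCat X) (functor_category (opposite DeltaInj) X)
    (normalize_obj X_split) (@normalize_nattrans X X_split)
    (@normalize_nattrans_id X X_split) (@normalize_nattrans_comp X X_split).

(** * The equivalence *)

Definition assembly_component (X : preadditive)
    (X_sums : has_finite_direct_sums X) (X_split : has_split_idempotents X)
    (C : functor CubeCat X) (k : nat) :
    hom (subset_sum X_sums (normalize_obj X_split C) k : obj X) (C k) :=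
  ds_copair _ (fun S : {set 'I_k} =>
    cact C (cube_inj (set_inj S)) \oc ns X_split C #|S|).

(** Knowing assembly on the legs of all [c] makes its naturality a matter of composing cubes. If [c]
    hits [-], both sides are zero. *)
Lemma assembly_component_leg (X : preadditive)
    (X_sums : has_finite_direct_sums X) (X_split : has_split_idempotents X)
    (C : functor CubeCat X) m k (c : cube_hom m k) :
  assembly_component X_sums X_split C k
    \oc subset_sum_leg X_sums (normalize_obj X_split C) c =
  cact C c \oc ns X_split C m.
Proof.
have [[i ci]|[T [d ->]]] := cube_factor_dec c.
  by rewrite (subset_sum_leg_minus _ _ ci) comp_zeror (cact_ns_minus _ _ ci).
rewrite subset_sum_leg_factor compA ds_copairE cact_comp -!compA.
congr (_ \oc _); exact: ns_normalize_map.
Qed.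

Lemma assembly_component_natural (X : preadditive)
    (X_sums : has_finite_direct_sums X) (X_split : has_split_idempotents X)
    (C : functor CubeCat X) k h (f : cube_hom k h) :
  assembly_component X_sums X_split C h
    \oc cubify_map X_sums (normalize_obj X_split C) f =
  cact C f \oc assembly_component X_sums X_split C k.
Proof.
apply: subset_sum_ext => S; rewrite -!compA cubify_map_leg.
by rewrite !assembly_component_leg cact_comp compA.
Qed.

Lemma assembly_component_natural2 (X : preadditive)
    (X_sums : has_finite_direct_sums X) (X_split : has_split_idempotents X)
    (C C' : functor CubeCat X) (t : nattrans C C') k :
  assembly_component X_sums X_split C' k
    \oc cubify_component X_sums (normalize_nattrans X_split t) k =
  t k \oc assembly_component X_sums X_split C k.
Proof.
apply: subset_sum_ext => S; rewrite -!compA cubify_component_leg.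
rewrite assembly_component_leg !compA assembly_component_leg cact_natural -!compA.
congr (_ \oc _); exact: ns_normalize_component.
Qed.

(** * Invertibility of assembly *)

(** Supplies the inductive step of [assembly_component_epi]: the degenerate part attached to [S]
    factors through a subset with one point fewer. The flag [false] matches [cube_kill], which sends
    the removed point to [-]. *)
Lemma cube_comp_inj_kill k (S : {set 'I_k}) (i : 'I_#|S|) (S' := S :\ set_inj S i) :
  cube_comp (cube_inj (set_inj S)) (cube_kill i) =
  cube_comp (cube_inj (set_inj S'))
    (cube_comp (cube_proj false (set_inj S')) (cube_inj (set_inj S))).
Proof.
apply: cube_hom_inner_ext => j.
rewrite -[LHS]/(cube_inj_fun (set_inj S) (cube_kill_fun i (Inner j))).
rewrite -[RHS]/(cube_inj_fun (set_inj S')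
  (cube_proj false (set_inj S') (Inner (set_inj S j)))).
rewrite [cube_kill_fun _ _]/= -(inj_eq (@dinj_inj _ _ (set_inj S))).
have jS : set_inj S j \in S by apply/set_injP; exists j.
case: ifPn => ij.
  rewrite cube_proj_notin // => l; apply/eqP => lj.
  have : set_inj S' l \in S' by apply/set_injP; exists l.
  by rewrite lj !inE ij.
have /set_injP[l jl] : set_inj S j \in S' by rewrite !inE ij.
by rewrite jl cube_proj_image; apply: (congr1 (@Inner k) jl).
Qed.

Lemma set_inj_setT k :
  cube_comp (cube_inj (set_inj setT)) (cube_proj true (set_inj setT)) =
  cube_id k.
Proof.
apply: cube_hom_inner_ext => j; have /set_injP[i ->] : j \in setT by [].
rewrite -[LHS]/(cube_inj_fun (set_inj setT)
  (cube_proj true (set_inj setT) (Inner (set_inj setT i)))).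
by rewrite cube_proj_image.
Qed.

(* By induction on [S], [x] and [y] agree on the image of
   [cact C (cube_inj (set_inj S))]: its degenerate part comes from smaller
   subsets, and its normal part from the summand [S]. *)
Lemma assembly_component_epi (X : preadditive)
    (X_sums : has_finite_direct_sums X) (X_split : has_split_idempotents X)
    (C : functor CubeCat X) k (Y : X) (x y : hom (C k) Y) :
  x \oc assembly_component X_sums X_split C k =
  y \oc assembly_component X_sums X_split C k -> x = y.
Proof.
move=> xy; suff xyS (S : {set 'I_k}) :
    x \oc cact C (cube_inj (set_inj S)) = y \oc cact C (cube_inj (set_inj S)).
  rewrite -[x]comp_idr -[y]comp_idr -cact_id -(set_inj_setT k) cact_comp.
  by rewrite !compA xyS.
have [n] := ubnP #|S|; elim: n S => // n IH S /ltnSE leSn.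
apply: (np_ext (n := normal_part X_split C #|S|)) => [|i].
  by rewrite -!compA -!(assembly_component_leg X_sums) !compA xy.
rewrite -!compA -!cact_comp cube_comp_inj_kill cact_comp !compA IH //.
rewrite (leq_trans _ leSn) // [X in _ < X](cardsD1 (set_inj S i)).
by rewrite (_ : set_inj S i \in S) //; apply/set_injP; exists i.
Qed.

(** Points outside [S] go to [-], so that the coordinate at [S] vanishes on each summand not
    contained in [S]. *)
Definition disassembly_component (X : preadditive)
    (X_sums : has_finite_direct_sums X) (X_split : has_split_idempotents X)
    (C : functor CubeCat X) (k : nat) :
    hom (C k) (subset_sum X_sums (normalize_obj X_split C) k) :=
  ds_pair _ (fun S : {set 'I_k} =>
    nr X_split C #|S| \oc cact C (cube_proj false (set_inj S))).

(** The matrix entry from [S] to [T] is the action of [cube_proj false (set_inj T)] after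
    [cube_inj (set_inj S)], cut down to normal parts. It is the identity for [S = T]; off the
    diagonal either a point of [T] is missed or a point of [S] goes to [-], and both give zero. *)
Lemma disassemblyK (X : preadditive)
    (X_sums : has_finite_direct_sums X) (X_split : has_split_idempotents X)
    (C : functor CubeCat X) k :
  disassembly_component X_sums X_split C k
    \oc assembly_component X_sums X_split C k =
  idm (subset_sum X_sums (normalize_obj X_split C) k : obj X).
Proof.
apply: ds_in_ext => S; apply: ds_out_ext => T.
rewrite -compA ds_copairE comp_idl compA ds_pairE.
rewrite -compA (compA _ _ (ns X_split C #|S|)) -cact_comp.
have [<-|neqST] := eqVneq S T.
  by rewrite cube_proj_cube_inj cact_id comp_idl nr_ns ds_out_in.
rewrite ds_out_in_neq //; case: (boolP (S \subset T)) => ST.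
  have /subsetPn[_ /set_injP[i ->] iS] : ~~ (T \subset S).
    by apply: contra neqST => TS; rewrite eqEsubset ST.
  rewrite compA (@nr_cact_miss _ _ _ _ _ _ i) ?comp_zerol // => j.
  rewrite -[X in X <> _]/(cube_proj false (set_inj T) (Inner (set_inj S j))).
  have /set_injP[l jl] : set_inj S j \in T.
    by apply: (subsetP ST); apply/set_injP; exists j.
  rewrite jl cube_proj_image => -[li]; case/negP: iS.
  by apply/set_injP; exists j; rewrite jl li.
have [_ /set_injP[i ->] iT] := subsetPn ST.
rewrite (@cact_ns_minus _ _ _ _ _ _ i) ?comp_zeror //.
rewrite -[LHS]/(cube_proj false (set_inj T) (Inner (set_inj S i))).
rewrite cube_proj_notin // => j; apply: contraNneq iT => <-.
by apply/set_injP; exists j.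
Qed.

(** Assembly is an epimorphism, so its left inverse is two-sided. *)
Lemma assemblyK (X : preadditive)
    (X_sums : has_finite_direct_sums X) (X_split : has_split_idempotents X)
    (C : functor CubeCat X) k :
  assembly_component X_sums X_split C k
    \oc disassembly_component X_sums X_split C k = idm (C k).
Proof.
apply: (@assembly_component_epi _ X_sums X_split).
by rewrite -compA disassemblyK comp_idl comp_idr.
Qed.

Definition assembly (X : preadditive)
    (X_sums : has_finite_direct_sums X) (X_split : has_split_idempotents X)
    (C : functor CubeCat X) :
    nattrans (cubify_obj X_sums (normalize_obj X_split C)) C :=
  @NatTrans CubeCat X (cubify_obj X_sums (normalize_obj X_split C)) C
    (assembly_component X_sums X_split C)
    (@assembly_component_natural X X_sums X_split C).

Lemma assembly_natural (X : preadditive)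
    (X_sums : has_finite_direct_sums X) (X_split : has_split_idempotents X)
    (C C' : functor CubeCat X) (t : nattrans C C') :
  nattrans_comp (assembly X_sums X_split C')
    (cubify_nattrans X_sums (normalize_nattrans X_split t)) =
  nattrans_comp t (assembly X_sums X_split C).
Proof. by apply: nattrans_ext => k; apply: assembly_component_natural2. Qed.

Lemma cubify_normalize_iso (X : preadditive)
    (X_sums : has_finite_direct_sums X) (X_split : has_split_idempotents X) :
  @isomorphic (functor_category (functor_category CubeCat X)
                                (functor_category CubeCat X))
    (functor_comp (cubify X_sums) (normalize X_split)) (functor_id _).
Proof.
pose t := @NatTrans (functor_category CubeCat X) (functor_category CubeCat X)
  (functor_comp (cubify X_sums) (normalize X_split)) (functor_id _)
  (assembly X_sums X_split) (@assembly_natural X X_sums X_split).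
exists t; apply: pointwise_iso_inverse => C.
apply: (@pointwise_iso_inverse _ _ _ _ (assembly X_sums X_split C)) => k.
exists (disassembly_component X_sums X_split C k).
by split; [apply: disassemblyK | apply: assemblyK].
Qed.

(** * The unit on semi-simplicial objects *)

Definition unit_component (X : preadditive)
    (X_sums : has_finite_direct_sums X) (X_split : has_split_idempotents X)
    (M : functor (opposite DeltaInj) X) (n : nat) :
    hom (M n) (normal_part X_split (cubify_obj X_sums M) n) :=
  nr X_split (cubify_obj X_sums M) n
    \oc subset_sum_leg X_sums M (cube_id n).

(** The leg of the identity lies in the normal part: [cube_kill i] turns it into the leg of
    [cube_kill i], which hits [-] and so is zero. *)
Lemma ns_unit_component (X : preadditive)
    (X_sums : has_finite_direct_sums X) (X_split : has_split_idempotents X)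
    (M : functor (opposite DeltaInj) X) n :
  ns X_split (cubify_obj X_sums M) n \oc unit_component X_sums X_split M n =
  subset_sum_leg X_sums M (cube_id n).
Proof.
apply: np_sr => i; apply: etrans (cubify_map_leg _ _ _ _) _.
by apply: (@subset_sum_leg_minus _ _ _ _ _ _ i); rewrite /= eqxx.
Qed.

Lemma unit_component_natural (X : preadditive)
    (X_sums : has_finite_direct_sums X) (X_split : has_split_idempotents X)
    (M : functor (opposite DeltaInj) X) m n (g : dinj_hom m n) :
  unit_component X_sums X_split M m \oc sact M g =
  normalize_map X_split (cubify_obj X_sums M) g
    \oc unit_component X_sums X_split M n.
Proof.
apply: ns_mono; rewrite [LHS]compA ns_unit_component.
rewrite [RHS]compA ns_normalize_map -[RHS]compA ns_unit_component.
rewrite [RHS]cubify_map_leg cube_comp_idr -[cube_proj true g]cube_comp_idl.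
by rewrite subset_sum_leg_proj.
Qed.

Lemma unit_component_natural2 (X : preadditive)
    (X_sums : has_finite_direct_sums X) (X_split : has_split_idempotents X)
    (M M' : functor (opposite DeltaInj) X) (t : nattrans M M') n :
  unit_component X_sums X_split M' n \oc t n =
  normalize_component X_split (cubify_nattrans X_sums t) n
    \oc unit_component X_sums X_split M n.
Proof.
apply: ns_mono; rewrite [LHS]compA ns_unit_component.
rewrite [RHS]compA ns_normalize_component -[RHS]compA ns_unit_component.
by rewrite [RHS]cubify_component_leg.
Qed.

(** The normal part of [cubify_obj X_sums M] lies in the top summand: if [i] is outside [S], the
    coordinate at [S] is unchanged by precomposition with the action of [cube_kill i], which
    vanishes on the normal part. *)
Lemma ds_in_out_ns (X : preadditive)
    (X_sums : has_finite_direct_sums X) (X_split : has_split_idempotents X)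
    (M : functor (opposite DeltaInj) X) n :
  ds_in (subset_sum X_sums M n) setT \oc (ds_out (subset_sum X_sums M n) setT
    \oc ns X_split (cubify_obj X_sums M) n) =
  ns X_split (cubify_obj X_sums M) n.
Proof.
apply: ds_out_ext => S; rewrite compA.
have [->|neqST] := eqVneq S setT; first by rewrite ds_out_in comp_idl.
rewrite ds_out_in_neq 1?eq_sym // comp_zerol.
have /subsetPn[i _ iS] : ~~ (setT \subset S) by rewrite subTset.
suff -> : ds_out (subset_sum X_sums M n) S =
    ds_out (subset_sum X_sums M n) S \oc cubify_map X_sums M (cube_kill i).
  rewrite -compA [X in _ \oc X](np_ps (normal_part X_split (cubify_obj X_sums M) n) i).
  by rewrite comp_zeror.
apply: subset_sum_ext => T; rewrite -compA cubify_map_leg.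
(* If [i] lies in [T], then [T] differs from [S] and both sides are zero; otherwise [cube_kill i]
   fixes the inclusion of [T]. *)
case: (boolP (i \in T)) => iT.
  have /set_injP[j ij] := iT.
  rewrite [X in _ = _ \oc X](@subset_sum_leg_minus _ _ _ _ _ _ j); last first.
    by rewrite /= -[Order.enum_val j]/(set_inj T j) -ij eqxx.
  rewrite comp_zeror subset_sum_leg_inj ds_out_in_neq //.
  by apply: contraNneq iS => <-.
rewrite cube_kill_comp // => j [ji]; case/negP: iT.
by apply/set_injP; exists j.
Qed.

Lemma unit_component_iso (X : preadditive)
    (X_sums : has_finite_direct_sums X) (X_split : has_split_idempotents X)
    (M : functor (opposite DeltaInj) X) n :
  exists g : hom (normal_part X_split (cubify_obj X_sums M) n : obj X) (M n),
    g \oc unit_component X_sums X_split M n = idm (M n) /\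
    unit_component X_sums X_split M n \oc g =
      idm (normal_part X_split (cubify_obj X_sums M) n : obj X).
Proof.
have [e ed de] : exists2 e : dinj_hom n #|[set: 'I_n]|,
    dinj_comp e (set_inj setT) = dinj_id _ & dinj_comp (set_inj setT) e = dinj_id n.
  by apply: dinj_bij => j; apply/set_injP; rewrite inE.
have leg_id : subset_sum_leg X_sums M (cube_id n) =
    ds_in _ setT \oc sact M (set_inj setT).
  by rewrite -set_inj_setT subset_sum_leg_factor.
(* The inverse projects to the top summand, then reindexes along [e] to pass from [M #|setT|] to
   [M n]. *)
exists (sact M e \oc (ds_out (subset_sum X_sums M n) setT
    \oc ns X_split (cubify_obj X_sums M) n)); split.
  rewrite -!(compA (sact M e)) -(compA (ds_out _ _)) ns_unit_component leg_id.
  by rewrite (compA (ds_out _ _)) ds_out_in comp_idl -sact_comp de sact_id.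
apply: ns_mono; rewrite [LHS]compA ns_unit_component leg_id comp_idr.
rewrite -(compA (ds_in _ _)) (compA (sact _ _) (sact _ _)) -sact_comp ed sact_id.
by rewrite comp_idl ds_in_out_ns.
Qed.

Definition normalization_unit (X : preadditive)
    (X_sums : has_finite_direct_sums X) (X_split : has_split_idempotents X)
    (M : functor (opposite DeltaInj) X) :
    nattrans M (normalize_obj X_split (cubify_obj X_sums M)) :=
  @NatTrans (opposite DeltaInj) X M
    (normalize_obj X_split (cubify_obj X_sums M))
    (unit_component X_sums X_split M)
    (fun n m g => @unit_component_natural X X_sums X_split M m n g).

Lemma normalization_unit_natural (X : preadditive)
    (X_sums : has_finite_direct_sums X) (X_split : has_split_idempotents X)
    (M M' : functor (opposite DeltaInj) X) (t : nattrans M M') :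
  nattrans_comp (normalization_unit X_sums X_split M') t =
  nattrans_comp (normalize_nattrans X_split (cubify_nattrans X_sums t))
    (normalization_unit X_sums X_split M).
Proof. by apply: nattrans_ext => n; apply: unit_component_natural2. Qed.

Lemma normalize_cubify_iso (X : preadditive)
    (X_sums : has_finite_direct_sums X) (X_split : has_split_idempotents X) :
  @isomorphic (functor_category (functor_category (opposite DeltaInj) X)
                                (functor_category (opposite DeltaInj) X))
    (functor_id _) (functor_comp (normalize X_split) (cubify X_sums)).
Proof.
pose t := @NatTrans (functor_category (opposite DeltaInj) X)
  (functor_category (opposite DeltaInj) X)
  (functor_id _) (functor_comp (normalize X_split) (cubify X_sums))
  (normalization_unit X_sums X_split)
  (@normalization_unit_natural X X_sums X_split).
exists t; apply: pointwise_iso_inverse => M.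
apply: (@pointwise_iso_inverse _ _ _ _ (normalization_unit X_sums X_split M)).
exact: unit_component_iso.
Qed.

Theorem mainTheorem4 (X : preadditive)
    (X_sums : has_finite_direct_sums X) (X_split : has_split_idempotents X) :
  equivalent (functor_category CubeCat X)
             (functor_category (opposite DeltaInj) X).
Proof.
exists (normalize X_split), (cubify X_sums); split; apply: isomorphic_sym.
  exact: cubify_normalize_iso.
exact: normalize_cubify_iso.
Qed.
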